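(* In the setting described in the context, let $\tau>0$, let $S:X\to\mathbb{R}^{n_s}$, $K:\mathbb{R}^{n_s}\to\mathbb{R}^{n_a}$, $C:\mathbb{R}^{n_a}\to X$ be linear maps, and put $L:=CKS:X\to X$. Consider the finite-channel tangent system for $(\vartheta,\nu,w)\in\mathbb{R}^n\times\mathbb{R}^n\times X$, $$\dot\vartheta=\nu,\qquad M\dot\nu=-D\nu-Br,\qquad \tau\dot w=W_*^{-1}CKSr,\qquad r=W_*B^\top\vartheta+W_*w .$$ Write $r=r_C+H_*h$ with $r_C=P_C^{W_*}r\in\mathcal{C}_*$ and $h=H_*^\top W_*^{-1}r\in\mathbb{R}^{b_1}$, and define the four blocks of $L$ relative to $X=\mathcal{C}_*\oplus\ker B$ (a $W_*^{-1}$-orthogonal direct sum) by $$L_{CC}:=P_C^{W_*}L\big|_{\mathcal{C}_*}:\mathcal{C}_*\to\mathcal{C}_*,\qquad L_{CH}:=P_C^{W_*}LH_*:\mathbb{R}^{b_1}\to\mathcal{C}_*,$$ $$L_{HC}:=H_*^\top W_*^{-1}L\big|_{\mathcal{C}_*}:\mathcal{C}_*\to\mathbb{R}^{b_1},\qquad L_{HH}:=H_*^\top W_*^{-1}LH_*:\mathbb{R}^{b_1}\to\mathbb{R}^{b_1}.$$ Then for every solution of the finite-channel tangent system, the variables $(\nu,r_C,h)$ satisfy the closed output system $$M\dot\nu=-D\nu-Br_C,$$ $$\tau\dot r_C=\tau W_*B^\top\nu+L_{CC}r_C+L_{CH}h,$$ $$\tau\dot h=L_{HC}r_C+L_{HH}h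 .$$ In particular, $$h(t)=e^{(t/\tau)L_{HH}}h(0)+\frac1\tau\int_0^te^{((t-s)/\tau)L_{HH}}L_{HC}r_C(s)\,ds .$$
   Context: $G=(V,E)$ is a finite connected graph with $n=|V|$, $m=|E|$, a fixed orientation of each edge, edge space $X=\mathbb{R}^E\cong\mathbb{R}^m$, and incidence matrix $B:X\to\mathbb{R}^n$ whose column for each oriented edge has entry $+1$ at the tail and $-1$ at the head; $b_1=m-n+1=\dim\ker B$. $M,D\in\mathbb{R}^{n\times n}$ are positive diagonal. Operating point: for line coefficients $a_e>0$ and $\theta_*\in\mathbb{R}^n$, $u_*\in X$, put $\eta_*=B^\top\theta_*+u_*$ and assume angle-cohesiveness: for some $0<\gamma<\pi/2$, $|\operatorname{pr}(\eta_{*,e})|\le\gamma$ for all $e\in E$, where $\operatorname{pr}(x)\in[-\pi,\pi)$ is the representative of $x$ modulo $2\pi$. Then $W_*=\operatorname{diag}\bigl(a_e\cos(\operatorname{pr}(\eta_{*,e}))\bigr)$ is positive diagonal. Weighted projections: $H_*:\mathbb{R}^{b_1}\to X$ is a linear map whose columns form a basis of $\ker B$ with $H_*^\top W_*^{-1}H_*=I_{b_1}$; $P_H^{W_*}=H_*H_*^\top W_*^{-1}$ is the $W_*^{-1}$-orthogonal projection onto $\ker B$, and $P_C^{W_*}=I-P_H^{W_*}$ is the projection onto the weighted cut space $\mathcal{C}_*=\operatorname{im}(W_*B^\top)=(\ker B)^{\perp_{W_*^{-1}}}$ (orthogonality for $x^\top W_*^{-1}y$). The tangent system is the linearization at $(\theta_*,0,u_*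 )$ of $\dot\theta=\omega$, $M\dot\omega=p-D\omega-Bf(\theta,u)$, $\tau\dot u=W_*^{-1}CKS(f(\theta,u)-f_* )$ with $f(\theta,u)=\operatorname{diag}(a)\sin(B^\top\theta+u)$, $f_*=f(\theta_*,u_* )$, $p=Bf_*$. *)

(* Defs.v *)
From HB Require Import structures.
From mathcomp Require Import all_boot all_order all_algebra.
From mathcomp Require Import all_classical all_reals all_analysis.

Set Implicit Arguments.
Unset Strict Implicit.
Unset Printing Implicit Defensive.

Import Order.TTheory GRing.Theory Num.Theory.
Import numFieldNormedType.Exports.

Local Open Scope classical_set_scope.
Local Open Scope ring_scope.

(* Vectors are column matrices. *)

(* Vertices are labelled by 'I_n and edges by 'I_m.  Self-loops are excluded
   (a column of the incidence matrix has a +1 and a -1); parallel edges are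
   allowed, simple graphs being a special case. *)
Record oriented_graph (n m : nat) := OrientedGraph {
  tail : 'I_m -> 'I_n;
  head : 'I_m -> 'I_n;
  tail_neq_head : forall e, tail e != head e }.

Definition adjacent n m (G : oriented_graph n m) : rel 'I_n := fun x y =>
  [exists e, ((tail G e == x) && (head G e == y))
          || ((tail G e == y) && (head G e == x))].

Definition graph_connected n m (G : oriented_graph n m) : Prop :=
  (0 < n)%N /\ forall x y : 'I_n, connect (adjacent G) x y.

(* m - n + 1; written so that truncated subtraction is harmless when the
   graph is a tree (n = m + 1). *)
Definition betti1 (n m : nat) : nat := (m.+1 - n)%N.

Definition incidence (R : realType) n m (G : oriented_graph n m) :
  'M[R]_(n, m) :=
  \matrix_(v, e) ((v == tail G e)%:R - (v == head G e)%:R).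

Definition pos_diag_mx (R : realType) n (A : 'M[R]_n) : Prop :=
  is_diag_mx A /\ forall i, 0 < A i i.

(* The representative of x modulo 2 pi in [-pi, pi). *)
Definition pr (R : realType) (x : R) : R :=
  x - (2 * pi) * (Num.floor ((x + pi) / (2 * pi)))%:~R.

Definition angle_cohesive (R : realType) m (eta : 'cV[R]_m) : Prop :=
  exists2 gamma : R, 0 < gamma < pi / 2
    & forall e : 'I_m, `|pr (eta e 0)| <= gamma.

Definition edge_weight_mx (R : realType) m (a : 'I_m -> R) (eta : 'cV[R]_m) :
  'M[R]_m :=
  diag_mx (\row_e (a e * cos (pr (eta e 0)))).

Definition mxfun (R : realType) p q (A : 'M[R]_(q, p)) :
  'Hom('cV[R]_p, 'cV[R]_q) :=
  linfun (mulmx A : 'cV[R]_p -> 'cV[R]_q).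

Definition ker_space (R : realType) n m (B : 'M[R]_(n, m)) :
  {vspace 'cV[R]_m} :=
  lker (mxfun B).

Definition cut_space (R : realType) n m (W : 'M[R]_m) (B : 'M[R]_(n, m)) :
  {vspace 'cV[R]_m} :=
  limg (mxfun (W *m B^T)).

Definition orthonormal_cycle_basis (R : realType) n m b (W : 'M[R]_m)
    (B : 'M[R]_(n, m)) (H : 'M[R]_(m, b)) : Prop :=
  basis_of (ker_space B) [seq col i H | i <- enum 'I_b]
  /\ H^T *m invmx W *m H = 1%:M.

Definition proj_H (R : realType) m b (W : 'M[R]_m) (H : 'M[R]_(m, b)) :
  'M[R]_m :=
  H *m H^T *m invmx W.

Definition proj_C (R : realType) m b (W : 'M[R]_m) (H : 'M[R]_(m, b)) :
  'M[R]_m :=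
  1%:M - proj_H W H.

(* [vsval] is the inclusion of the cut space in the edge space.  [vsproj] is
   the corresponding corestriction: it is only meaningful on vectors that lie
   in the cut space, where it does not change the underlying vector
   ([vsprojK]). *)
Definition block_CC (R : realType) n m b (W : 'M[R]_m) (B : 'M[R]_(n, m))
    (H : 'M[R]_(m, b)) (L : 'M[R]_m) :
  'Hom(subvs_of (cut_space W B), subvs_of (cut_space W B)) :=
  (linfun (vsproj (cut_space W B)) \o mxfun (proj_C W H *m L)
     \o linfun (@vsval _ _ (cut_space W B)))%VF.

Definition block_CH (R : realType) n m b (W : 'M[R]_m) (B : 'M[R]_(n, m))
    (H : 'M[R]_(m, b)) (L : 'M[R]_m) :
  'Hom('cV[R]_b, subvs_of (cut_space W B)) :=
  (linfun (vsproj (cut_space W B)) \o mxfun (proj_C W H *m L *m H))%VF.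

Definition block_HC (R : realType) n m b (W : 'M[R]_m) (B : 'M[R]_(n, m))
    (H : 'M[R]_(m, b)) (L : 'M[R]_m) :
  'Hom(subvs_of (cut_space W B), 'cV[R]_b) :=
  (mxfun (H^T *m invmx W *m L) \o linfun (@vsval _ _ (cut_space W B)))%VF.

Definition block_HH (R : realType) m b (W : 'M[R]_m) (H : 'M[R]_(m, b))
    (L : 'M[R]_m) : 'M[R]_b :=
  H^T *m invmx W *m L *m H.

(* x has derivative v at t relative to the time domain J: two-sided at
   interior points, one-sided at endpoints of J belonging to J. *)
Definition has_deriv_within (R : realType) (V : normedModType R) (J : set R)
    (x : R -> V) (t : R) (v : V) : Prop :=
  (fun s => (s - t)^-1 *: (x s - x t)) @ within J t^' --> v.

(* tangent_output is r; a tangent solution on J satisfies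
   vartheta' = nu,  M nu' = - D nu - B r,  tau w' = W^-1 C K S r. *)
Definition tangent_output (R : realType) n m (W : 'M[R]_m) (B : 'M[R]_(n, m))
    (vartheta : R -> 'cV[R]_n) (w : R -> 'cV[R]_m) (t : R) : 'cV[R]_m :=
  W *m B^T *m vartheta t + W *m w t.

Definition tangent_solution (R : realType) n m ns na
    (M D : 'M[R]_n) (W : 'M[R]_m) (B : 'M[R]_(n, m)) (tau : R)
    (S : 'M[R]_(ns, m)) (K : 'M[R]_(na, ns)) (C : 'M[R]_(m, na))
    (J : set R) (vartheta nu : R -> 'cV[R]_n) (w : R -> 'cV[R]_m) : Prop :=
  let r := tangent_output W B vartheta w in
  forall t, J t ->
  [/\ has_deriv_within J vartheta t (nu t),
      (exists2 dnu, has_deriv_within J nu t dnu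
        & M *m dnu = - (D *m nu t) - B *m r t)
    & (exists2 dw, has_deriv_within J w t dw
        & tau *: dw = invmx W *m (C *m K *m S *m r t))].

Definition expmx (R : realType) b (A : 'M[R]_b) : 'M[R]_b :=
  limn (series (fun k : nat => (k`!%:R)^-1 *: (A ^+ k : 'M[R]_b))).

(* Entrywise integral from x to y, with the usual sign when y < x. *)
Definition vec_integral (R : realType) p (f : R -> 'cV[R]_p) (x y : R) :
  'cV[R]_p :=
  \col_i (if x <= y
          then \int[lebesgue_measure]_(s in `[x, y]) f s i 0
          else - \int[lebesgue_measure]_(s in `[y, x]) f s i 0).

(* Main.v *)
Require Import Defs.
From HB Require Import structures.
From mathcomp Require Import all_boot all_order all_algebra.
From mathcomp Require Import all_classical all_reals all_analysis.
From mathcomp Require Import ring.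

Set Implicit Arguments.
Unset Strict Implicit.
Unset Printing Implicit Defensive.

Import Order.TTheory GRing.Theory Num.Theory.
Import numFieldNormedType.Exports.

Local Open Scope classical_set_scope.
Local Open Scope ring_scope.

(** The proof separates linear algebra from one fact about linear ODEs.

    Linear algebra.  Since [B *m H = 0], the row operator [H^T *m invmx W], which
    reads off the cycle coordinate [h], kills [im (W *m B^T)], while
    [proj_C W H] fixes it pointwise.  The output satisfies
    [tau r' = tau W B^T nu + L r], because [W] cancels the [invmx W] of the
    equation of [w].  Applying the two operators to it gives the equations of
    [h] and [rC], once [r] is replaced by [rC + H h]; and [B r = B rC] for the
    same reason.  The point that needs an argument is that [proj_C W H] takes
    its values in the cut space ([proj_C_cut]): its values are orthogonal to the
    columns of [H] for the form [invmx W], and a vector orthogonal to the whole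
    cycle space [ker B] is a cut, by the duality between the row space and the
    kernel of a matrix.  So every vector is the sum of a cut and a cycle, and
    the cycle coordinate shows that this decomposition is unique.

    Variation of constants.  If [tau h' = f + A h] on an interval, then
    [s |-> tau exp (((t - s) / tau) A) h s] has derivative
    [exp (((t - s) / tau) A) f s], and the fundamental theorem of calculus
    between 0 and [t] is the announced formula ([variation_of_constants]).  It
    remains to compute the derivative of the exponential ([is_derive_expmx]):
    the entries of [expmx (x *: A)] are power series in [x] that converge
    everywhere and may be differentiated termwise.  Derivatives are relative to
    a time domain that may contain its endpoints, so the rules of calculus
    are first established for relative derivatives. *)

(** * Cut space and cycle space *)

Lemma mxfunE (R : realType) p q (A : 'M[R]_(q, p)) (x : 'cV[R]_p) :
  mxfun A x = A *m x.
Proof. by rewrite /mxfun lfunE. Qed.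

(** Cohesiveness keeps every angle in the open interval (-pi/2, pi/2), where the
    cosine is positive. *)
Lemma edge_weight_unitmx (R : realType) m (a : 'I_m -> R) (eta : 'cV[R]_m) :
  (forall e, 0 < a e) -> angle_cohesive eta -> edge_weight_mx a eta \in unitmx.
Proof.
move=> a_gt0 [gamma /andP[_ gamma_lt] eta_le].
rewrite unitmxE det_diag unitfE; apply/prodf_neq0 => e _.
rewrite mxE mulf_neq0 ?gt_eqF// cos_gt0_pihalf//.
by rewrite -ltr_norml (le_lt_trans (eta_le e)).
Qed.

Section WeightedSplitting.
Variables (R : realType) (n m b : nat).
Variables (B : 'M[R]_(n, m)) (W : 'M[R]_m) (H : 'M[R]_(m, b)).
Hypotheses (W_sym : W^T = W) (W_unit : W \in unitmx).
Hypothesis H_basis : orthonormal_cycle_basis W B H.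

Lemma mem_ker_space x : (x \in ker_space B) = (B *m x == 0).
Proof. by rewrite memv_ker mxfunE. Qed.

Lemma mem_cut_space x : x \in cut_space W B -> exists y, x = W *m B^T *m y.
Proof. by case/memv_imgP => y _ ->; exists y; rewrite mxfunE. Qed.

Lemma mulmx_cycle_basis : B *m H = 0.
Proof.
case: H_basis => Hb _; apply/matrixP => i j.
have : col j H \in ker_space B.
  by apply: (basis_mem Hb); apply: map_f; rewrite mem_enum.
by rewrite mem_ker_space => /eqP/matrixP/(_ i 0); rewrite colE mulmxA -colE !mxE.
Qed.

Lemma cycle_basis_span p (Y : 'M[R]_(m, p)) :
  B *m Y = 0 -> exists X, Y = H *m X.
Proof.
case: H_basis => Hb _ BY0.
suff /choice[f fP] (j : 'I_p) : exists x : 'cV[R]_b, col j Y = H *m x.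
  exists (\matrix_(i, j) f j i 0); apply/matrixP => i j.
  have /matrixP/(_ i 0) := fP j; rewrite !mxE => ->.
  by apply: eq_bigr => k _; rewrite mxE.
have : col j Y \in ker_space B.
  by rewrite mem_ker_space colE mulmxA BY0 mul0mx eqxx.
pose cols := in_tuple [seq col i H | i <- enum 'I_b].
rewrite -(span_basis Hb) => /(@coord_span _ _ _ cols) ->.
elim/big_ind : _ => [|_ _ [x ->] [y ->]|k _].
- by exists 0; rewrite mulmx0.
- by exists (x + y); rewrite mulmxDr.
have /mapP[i _ ->] : cols`_k \in [seq col i H | i <- enum 'I_b].
  by rewrite mem_nth.
exists (coord cols k (col j Y) *: delta_mx i 0).
by rewrite -scalemxAr -colE.
Qed.

(** [H^T *m B^T] is the transpose of [B *m H], and so the cycle coordinate of a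
    cut vanishes. *)
Lemma cycle_coord_cut : H^T *m invmx W *m (W *m B^T) = 0.
Proof. by rewrite mulmxA mulmxKV// -trmx_mul mulmx_cycle_basis trmx0. Qed.

Lemma cycle_coord_cut_mem x : x \in cut_space W B -> H^T *m invmx W *m x = 0.
Proof.
by move=> /mem_cut_space[y ->]; rewrite mulmxA cycle_coord_cut mul0mx.
Qed.

Lemma proj_C_cut_mx : proj_C W H *m (W *m B^T) = W *m B^T.
Proof.
by rewrite /proj_C /proj_H mulmxBl mul1mx -(mulmxA H) -(mulmxA H)
  cycle_coord_cut mulmx0 subr0.
Qed.

(** A vector is a cut as soon as its transpose lies in the row space of [B *m W],
    that is, annihilates [N], the cokernel of that matrix.  The columns of
    [W *m N] lie in [ker B], hence are combinations of the columns of [H], and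
    [proj_C W H *m x] is orthogonal to those for the form [invmx W]. *)
Lemma proj_C_cut x : proj_C W H *m x \in cut_space W B.
Proof.
pose N := cokermx (B *m W).
have [X WN] : exists X, W *m N = H *m X.
  by apply: cycle_basis_span; rewrite mulmxA mulmx_coker.
have NE : N = invmx W *m H *m X by rewrite -mulmxA -WN mulKmx.
have : ((proj_C W H *m x)^T <= B *m W)%MS.
  rewrite submxE -/N NE.
  suff PH0 : (proj_C W H *m x)^T *m (invmx W *m H) = 0.
    by rewrite mulmxA PH0 mul0mx.
  apply: trmx_inj; rewrite trmx0 trmx_mul trmxK trmx_mul trmx_inv W_sym.
  case: H_basis => _ HH; rewrite /proj_C /proj_H mulmxA mulmxBr mulmx1.
  by rewrite !mulmxA HH mul1mx subrr mul0mx.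
case/submxP => y /(congr1 trmx); rewrite trmxK !trmx_mul W_sym => ->.
by apply/memv_imgP; exists y^T; rewrite ?memvf// mxfunE.
Qed.

Lemma cut_cycle_split (x : 'cV[R]_m) :
  x = proj_C W H *m x + H *m (H^T *m invmx W *m x).
Proof. by rewrite /proj_C /proj_H mulmxBl mul1mx !mulmxA subrK. Qed.

Lemma cut_orthogonal_ker x y : x \in cut_space W B -> y \in ker_space B ->
  x^T *m invmx W *m y = 0.
Proof.
case/mem_cut_space => z ->; rewrite mem_ker_space => /eqP By0.
by rewrite !trmx_mul trmxK W_sym mulmxA mulmxK// -mulmxA By0 mulmx0.
Qed.

Lemma cut_add_ker : (cut_space W B + ker_space B)%VS = fullv.
Proof.
apply/eqP; rewrite eqEsubv subvf /=; apply/subvP => x _.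
rewrite [x]cut_cycle_split memv_add ?proj_C_cut// mem_ker_space.
by rewrite mulmxA mulmx_cycle_basis mul0mx.
Qed.

(** A cut [H *m y] has coordinate [y], because [H] is orthonormal, and has
    coordinate 0, being a cut. *)
Lemma cut_directv_ker : directv (cut_space W B + ker_space B).
Proof.
rewrite directv_addE !directv_trivial /=; apply/eqP/vspaceP => x.
rewrite memv_cap memv0; apply/andP/eqP => [[xC]|->]; last by rewrite !mem0v.
rewrite mem_ker_space => /eqP/cycle_basis_span[y xE].
move: (cycle_coord_cut_mem xC); case: H_basis => _ HH.
by rewrite xE mulmxA HH mul1mx => ->; rewrite mulmx0.
Qed.

Lemma mulmx_proj_C (x : 'cV[R]_m) : B *m (proj_C W H *m x) = B *m x.
Proof.
by rewrite {2}[x]cut_cycle_split mulmxDr (mulmxA B H) mulmx_cycle_basis mul0mx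
  addr0.
Qed.

(** The typed blocks act as plain matrices: their corestrictions to the cut
    space are harmless because [proj_C W H] takes its values there. *)
Section Blocks.
Variable L : 'M[R]_m.

Lemma block_CCE x : x \in cut_space W B ->
  vsval (block_CC W B H L (vsproj (cut_space W B) x)) = proj_C W H *m L *m x.
Proof.
move=> xC; rewrite /block_CC !comp_lfunE mxfunE !lfunE /= (vsprojK xC) vsprojK//.
by rewrite -mulmxA proj_C_cut.
Qed.

Lemma block_CHE x :
  vsval (block_CH W B H L x) = proj_C W H *m L *m H *m x.
Proof.
by rewrite /block_CH comp_lfunE mxfunE !lfunE /= vsprojK// -!mulmxA proj_C_cut.
Qed.

Lemma block_HCE x : x \in cut_space W B ->
  block_HC W B H L (vsproj (cut_space W B) x) = H^T *m invmx W *m L *m x.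
Proof.
by move=> xC; rewrite /block_HC comp_lfunE mxfunE lfunE /= vsprojK.
Qed.

End Blocks.
End WeightedSplitting.

(** * Derivatives relative to a time domain *)

Lemma cvg_mxP (R : numFieldType) T (F : set_system T) {FF : Filter F} m n
    (f : T -> 'M[R]_(m, n)) (l : 'M[R]_(m, n)) :
  f @ F --> l <-> forall i j, (fun t => f t i j) @ F --> l i j.
Proof.
split=> [fl i j|fl A [P lP PA]].
  exact: (cvg_comp _ _ fl (@coord_continuous R m n i j l)).
have : F (fun t => forall i j, P i j (f t i j)).
  by do 2![apply: filter_forall => ?]; apply: fl; exact: lP.
by move/filterS; apply => t Pt; apply: PA.
Qed.

Lemma cvg_mulmx (R : numFieldType) T (F : set_system T) {FF : Filter F} m n p
    (f : T -> 'M[R]_(m, n)) (g : T -> 'M[R]_(n, p))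
    (a : 'M[R]_(m, n)) (b : 'M[R]_(n, p)) :
  f @ F --> a -> g @ F --> b -> (fun t => f t *m g t) @ F --> a *m b.
Proof.
move=> /cvg_mxP fa /cvg_mxP gb; apply/cvg_mxP => i j; rewrite mxE.
under eq_fun do rewrite mxE.
by apply: cvg_big => [|k _]; [exact: add_continuous | exact: cvgM].
Qed.

Section Derivatives.
Variable R : realType.
Implicit Types J : set R.

Lemma has_deriv_within_mxP J m n (M : R -> 'M[R]_(m, n)) t M' :
  has_deriv_within J M t M' <->
  forall i j, has_deriv_within J (fun s => M s i j) t (M' i j).
Proof.
have qE i j : (fun s => ((s - t)^-1 *: (M s - M t)) i j)
    = (fun s => (s - t)^-1 *: (M s i j - M t i j)).
  by apply/funext => s; rewrite !mxE.
split=> [/cvg_mxP dM i j|dM]; first by rewrite /has_deriv_within -qE.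
by apply/cvg_mxP => i j; rewrite qE; exact: dM.
Qed.

Lemma has_deriv_withinD J (V : normedModType R) (x y : R -> V) t v u :
  has_deriv_within J x t v -> has_deriv_within J y t u ->
  has_deriv_within J (fun s => x s + y s) t (v + u).
Proof.
move=> dx dy; rewrite /has_deriv_within.
under eq_fun do rewrite opprD addrACA scalerDr.
exact: cvgD.
Qed.

Lemma within_dnbhs_cvg J (t : R) : within J t^' `=>` nbhs t.
Proof. by apply: cvg_trans (@nbhs_dnbhs _ t); exact: cvg_within. Qed.

(** [x s - x t] is the difference quotient times [s - t]. *)
Lemma has_deriv_within_cvg J (V : normedModType R) (x : R -> V) t v :
  has_deriv_within J x t v -> x @ within J (nbhs t) --> x t.
Proof.
move=> dx.
have x_t : x @ within J t^' --> x t.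
  have st : (fun s => s - t) @ within J t^' --> 0.
    rewrite -(subrr t); apply: cvgB; last exact: cvg_cst.
    exact: within_dnbhs_cvg.
  have : (s - t) *: ((s - t)^-1 *: (x s - x t)) + x t @[s --> within J t^']
      --> 0 *: v + x t.
    by apply: cvgD; [exact: cvgZ | exact: cvg_cst].
  rewrite scale0r add0r; apply: cvg_trans.
  apply: (@near_eq_cvg _ _ (within J t^')).
  rewrite /= near_withinE; near=> s => Js.
  rewrite /= scalerA divff ?scale1r ?subrK// subr_eq0.
  by near: s; exact: nbhs_dnbhs_neq.
move=> A xA; have := x_t _ xA; have := nbhs_singleton xA.
move=> At tA; suff : \forall s \near t, J s -> A (x s) by [].
have {}tA : \forall s \near t, s != t -> J s -> A (x s) by exact: tA.
near=> s => Js; have [->|st] := eqVneq s t; first exact: At.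
by move: st Js; near: s; exact: tA.
Unshelve. all: by end_near. Qed.

(** The usual splitting
    [E s h s - E t h t = (E s - E t) h s + E t (h s - h t)]. *)
Lemma has_deriv_within_mulmx J m n p
    (E : R -> 'M[R]_(m, n)) (h : R -> 'M[R]_(n, p)) t E' h' :
  has_deriv_within J E t E' -> has_deriv_within J h t h' ->
  has_deriv_within J (fun s => E s *m h s) t (E' *m h t + E t *m h').
Proof.
move=> dE dh; rewrite /has_deriv_within.
have -> : (fun s => (s - t)^-1 *: (E s *m h s - E t *m h t)) =
  (fun s => ((s - t)^-1 *: (E s - E t)) *m h s
    + E t *m ((s - t)^-1 *: (h s - h t))).
  apply/funext => s.
  by rewrite -scalemxAl -scalemxAr -scalerDr mulmxBl mulmxBr addrA subrK.
apply: cvgD; apply: cvg_mulmx => //; last exact: cvg_cst.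
apply: cvg_trans (has_deriv_within_cvg dh); apply: cvg_app.
by move=> A; exact: nbhs_dnbhs.
Qed.

Lemma has_deriv_within_mulmxl J m n p (A : 'M[R]_(m, n)) (h : R -> 'M[R]_(n, p))
    t h' :
  has_deriv_within J h t h' ->
  has_deriv_within J (fun s => A *m h s) t (A *m h').
Proof.
move=> dh; rewrite /has_deriv_within.
under eq_fun do rewrite -mulmxBr scalemxAr.
by apply: cvg_mulmx => //; exact: cvg_cst.
Qed.

Lemma is_derive_has_deriv_within J (f : R -> R) (t l : R) :
  is_derive t (1 : R) f l -> has_deriv_within J f t l.
Proof.
case=> /cvg_ex[/= l' fl'] fl; rewrite /has_deriv_within.
have {fl} <- : l' = l by rewrite -fl; apply/esym/cvg_lim.
have inj y : y - t = t - t -> y = t by exact: addIr.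
have c : {for t, continuous (fun s : R => s - t)}.
  by apply: cvgB; [exact: cvg_id|exact: cvg_cst].
have := continuous_injective_withinNx c inj; rewrite subrr => st.
have := cvg_comp _ _ st fl'.
move/(cvg_within_filter J); apply: cvg_trans.
apply: near_eq_cvg; apply: nearW => s /=.
by rewrite [_ *: 1]mulr1 subrK.
Qed.

Lemma has_deriv_within_is_derive J (f : R -> R) (t l : R) :
  nbhs t J -> has_deriv_within J f t l -> is_derive t (1 : R) f l.
Proof.
move=> tJ fl.
have inj y : y + t = 0 + t -> y = 0 by exact: addIr.
have c : {for 0, continuous (fun s : R => s + t)}.
  by apply: cvgD; [exact: cvg_id|exact: cvg_cst].
have := continuous_injective_withinNx c inj; rewrite add0r => st.
have {}fl : (s - t)^-1 *: (f s - f t) @[s --> t^'] --> l.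
  move=> A /fl fA; suff : \forall s \near t^', A ((s - t)^-1 *: (f s - f t)) by [].
  have {}fA : \forall s \near t^', J s -> A ((s - t)^-1 *: (f s - f t)).
    exact: fA.
  by apply: filterS2 (nbhs_dnbhs tJ) fA => s Js; apply.
have {}fl := cvg_comp _ _ st fl.
have {}fl : h^-1 *: ((f \o shift t) (h *: 1) - f t) @[h --> 0^'] --> l.
  apply: cvg_trans fl; apply: near_eq_cvg; apply: nearW => s /=.
  by rewrite [_ *: 1]mulr1 addrK.
by split; [apply/cvg_ex; exists l | apply/cvg_lim].
Qed.

End Derivatives.

(** The fundamental theorem of calculus asks for two-sided derivatives only at
    interior points, where relative derivatives are two-sided. *)
Lemma Rintegral_has_deriv_within (R : realType) (J : set R) (F f : R -> R)
    (x y : R) :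
  is_interval J -> J x -> J y -> x <= y ->
  (forall s, J s -> has_deriv_within J F s (f s)) ->
  (forall s, J s -> f @ within J (nbhs s) --> f s) ->
  \int[lebesgue_measure]_(s in `[x, y]) f s = F y - F x.
Proof.
move=> J_itv Jx Jy; rewrite le_eqVlt => /predU1P[->|xy] dF cf.
  by rewrite set_itv1 Rintegral_set1 subrr.
have xyJ : `[x, y]%classic `<=` J.
  by move=> s /=; rewrite in_itv/= => xsy; exact: J_itv Jx Jy _ xsy.
have cont (g : R -> R) : (forall s, J s -> g @ within J (nbhs s) --> g s) ->
    {within `[x, y], continuous g}.
  move=> cg; apply/subspace_continuousP => s sxy.
  by apply: cvg_trans (cg s (xyJ s sxy)); apply: cvg_app; exact: within_subset.
have [_ Fx Fy] := (continuous_within_itvP F xy).1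
  (cont F (fun s Js => has_deriv_within_cvg (dF s Js))).
have dF1 s : s \in `]x, y[ -> is_derive s (1 : R) F (f s).
  move=> sxy; have Js : J s by apply: xyJ; exact: subset_itv_oo_cc.
  apply: has_deriv_within_is_derive (dF s Js).
  have xys : \forall z \near s, z \in `]x, y[ by exact: near_in_itvoo.
  apply: (filterS _ xys) => z zxy.
  by apply: xyJ; exact: subset_itv_oo_cc.
rewrite /Rintegral (continuous_FTC2 xy (cont f cf) (F := F))//.
  by split=> // s /dF1[].
by move=> s /dF1 dFs; rewrite derive1E; exact: derive_val.
Qed.

(** * Derivative of the matrix exponential *)

Section MatrixExponential.
Variables (R : realType) (b : nat).
Implicit Types (A : 'M[R]_b) (x : R) (i j : 'I_b).

(** The coefficients of the power series in [x] of an entry of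
    [expmx (x *: A) *m A ^+ p].  The shift [p] makes the family stable under
    termwise differentiation, which raises [p] by 1. *)
Definition expmx_coef A p i j (k : nat) : R := (k`!%:R)^-1 * (A ^+ (k + p)) i j.

Lemma expr_mx_entry_le A k i j : `|(A ^+ k) i j| <= (b%:R * `|A|) ^+ k.
Proof.
elim: k i j => [|k IHk] i j.
  by rewrite !expr0 mxE; case: (i == j); rewrite /= ?normr1 ?normr0.
rewrite !exprS -mulmxE mxE (le_trans (ler_norm_sum _ _ _))//.
have -> : b%:R * `|A| * (b%:R * `|A|) ^+ k
  = \sum_(l < b) (`|A| * (b%:R * `|A|) ^+ k).
  by rewrite sumr_const card_ord -mulrA mulr_natl.
apply: ler_sum => l _; rewrite normrM ler_pM//.
by rewrite [leRHS]/Num.Def.normr /= mx_normrE; exact: (le_bigmax _ _ (i, l)).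
Qed.

(** Entries of [A ^+ k] grow at most geometrically in [k], so that the series is
    dominated by a multiple of an exponential series. *)
Lemma is_cvg_pseries_expmx A p i j x : cvgn (pseries (expmx_coef A p i j) x).
Proof.
have : 0 <= b%:R * `|A| by rewrite mulr_ge0.
move: (expr_mx_entry_le A); move: (b%:R * `|A|) => c A_le c_ge0.
apply: normed_cvg; rewrite /normed_series_of.
apply: (@series_le_cvg _ _ (c ^+ p *: exp_coeff (c * `|x|))) => [k|k|k|].
- exact: normr_ge0.
- by rewrite mulr_ge0 ?exprn_ge0 ?exp_coeff_ge0// mulr_ge0.
- rewrite /= /expmx_coef !normrM normfV normr_nat normrX.
  have -> : (c ^+ p *: exp_coeff (c * `|x|)) k
      = (k`!%:R)^-1 * c ^+ (k + p) * `|x| ^+ k.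
    by rewrite -[LHS]/(c ^+ p * ((c * `|x|) ^+ k / k`!%:R)) exprMn exprD; ring.
  rewrite ler_wpM2r ?exprn_ge0// ler_wpM2l ?invr_ge0//; exact: A_le.
- exact/is_cvg_seriesZ/is_cvg_series_exp_coeff.
Qed.

Lemma pseries_diffs_expmx_coef A p i j :
  pseries_diffs (expmx_coef A p i j) = expmx_coef A p.+1 i j.
Proof.
apply/funext => k; rewrite /pseries_diffs /expmx_coef addnS addSn mulrA.
by rewrite factS natrM invfM mulrA divff ?mul1r// pnatr_eq0.
Qed.

Lemma exprZ_mx A x k : (x *: A) ^+ k = x ^+ k *: A ^+ k.
Proof.
elim: k => [|k IHk]; first by rewrite !expr0 scale1r.
by rewrite !exprS IHk -!mulmxE -scalemxAl -scalemxAr scalerA.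
Qed.

(** Multiplication by [A ^+ p] and the entries are continuous on matrices, so
    they commute with the limit that defines the exponential. *)
Lemma expmx_entry A x p i j :
  (expmx (x *: A) *m A ^+ p) i j = limn (pseries (expmx_coef A p i j) x).
Proof.
pose u k : 'M[R]_b := (k`!%:R)^-1 *: (x *: A) ^+ k.
have uE q k0 i0 j0 : (series u k0 *m A ^+ q) i0 j0
    = pseries (expmx_coef A q i0 j0) x k0.
  rewrite /pseries !seriesEord /= mulmx_suml summxE; apply: eq_bigr => k _.
  rewrite /u exprZ_mx -!scalemxAl mulmxE -exprD !mxE /expmx_coef.
  by rewrite mulrA mulrAC.
(* [expmx] is a limit only if the series converges, which holds entrywise. *)
have u_cvg : series u @ \oo --> expmx (x *: A).
  have u_mx : series u @ \oo -->
      (\matrix_(k, l) limn (pseries (expmx_coef A 0 k l) x) : 'M[R]_b).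
    apply/cvg_mxP => k l; rewrite mxE.
    under eq_fun do rewrite -[series u _]mulmx1 (uE 0%N).
    exact: is_cvg_pseries_expmx.
  by rewrite /expmx; apply: cvgP u_mx.
have : (fun k => series u k *m A ^+ p) @ \oo --> expmx (x *: A) *m A ^+ p.
  by apply: cvg_mulmx => //; exact: cvg_cst.
move=> /cvg_mxP/(_ i j); under eq_fun do rewrite uE.
by move=> /cvg_lim <-.
Qed.

Lemma expmx0 : expmx (0 : 'M[R]_b) = 1%:M.
Proof.
apply/matrixP => i j.
have := expmx_entry 0 0 0 i j; rewrite scale0r mulmx1 => ->.
apply/cvg_lim => //; rewrite -cvg_shiftS.
suff -> : [sequence pseries (expmx_coef 0 0 i j) 0 k.+1]_k
    = cst ((1%:M : 'M[R]_b) i j).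
  exact: cvg_cst.
apply/funext => k; rewrite /pseries seriesEord /= big_ord_recl big1 => [|l _].
  by rewrite /expmx_coef fact0 invr1 mul1r addr0 mulr1.
by rewrite expr0n mulr0.
Qed.

(** Termwise differentiation at [x] requires convergence at a point of larger
    modulus, here [`|x| + 1]. *)
Lemma is_derive_expmx A x i j :
  is_derive x (1 : R) (fun y => expmx (y *: A) i j) ((expmx (x *: A) *m A) i j).
Proof.
have -> : (fun y => expmx (y *: A) i j)
    = (fun y => limn (pseries (expmx_coef A 0 i j) y)).
  by apply/funext => y; rewrite -expmx_entry mulmx1.
have := expmx_entry A x 1 i j; rewrite expr1 => ->.
rewrite -pseries_diffs_expmx_coef.
apply: (@pseries_snd_diffs _ _ (`|x| + 1)); rewrite ?pseries_diffs_expmx_coef;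
  try exact: is_cvg_pseries_expmx.
by rewrite [ltRHS]ger0_norm ?addr_ge0// ltrDl.
Qed.

Lemma has_deriv_within_expmx_flow (J : set R) A (t tau s : R) :
  has_deriv_within J (fun y => expmx (((t - y) / tau) *: A)) s
    (- tau^-1 *: (expmx (((t - s) / tau) *: A) *m A)).
Proof.
apply/has_deriv_within_mxP => i j; rewrite mxE.
have dlin : is_derive s (1 : R) (fun y => (t - y) / tau) (- tau^-1).
  have -> : (fun y => (t - y) / tau) = tau^-1 \*: (cst t - id).
    by apply/funext => y; rewrite mulrC.
  apply: is_derive_eq (is_deriveZ _
    (is_deriveB (is_derive_cst _ _ _) (is_derive_id _ _))) _.
  by rewrite sub0r scalerN [_ *: _]mulr1.
have := @is_derive1_comp R (fun y => expmx (y *: A) i j)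
  (fun y => (t - y) / tau) s _ _
  (is_derive_expmx A ((t - s) / tau) i j) dlin.
by rewrite mulrC => /(is_derive_has_deriv_within J).
Qed.

End MatrixExponential.

(** * Variation of constants *)

(** With [E s] the exponential in the integrand, [s |-> E s (tau h s)] has
    derivative [- E (A h) + E (f + A h) = E f]: the factor [tau] cancels the
    [tau^-1] that comes from the exponential. *)
Lemma variation_of_constants (R : realType) b (J : set R) (A : 'M[R]_b)
    (tau : R) (h f : R -> 'cV[R]_b) :
  is_interval J -> tau != 0 -> J 0 ->
  (forall s, J s -> exists2 dh, has_deriv_within J h s dh
    & tau *: dh = f s + A *m h s) ->
  (forall s, J s -> f @ within J (nbhs s) --> f s) ->
  forall t, J t ->
  h t = expmx ((t / tau) *: A) *m h 0
    + tau^-1 *: vec_integral (fun s => expmx (((t - s) / tau) *: A) *m f s) 0 t.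
Proof.
move=> J_itv tau0 J0 dh cf t Jt.
pose E s := expmx (((t - s) / tau) *: A).
pose F s := E s *m (tau%:M *m h s).
have dE s := @has_deriv_within_expmx_flow R b J A t tau s.
have dF s : J s -> has_deriv_within J F s (E s *m f s).
  move=> Js; have [dhs hs dhE] := dh s Js.
  have := has_deriv_within_mulmx (dE s) (has_deriv_within_mulmxl (A := tau%:M) hs).
  congr has_deriv_within.
  rewrite !mul_scalar_mx dhE -/(E s) mulmxDr -scalemxAl -scalemxAr scalerA.
  by rewrite mulNr mulVf// scaleN1r mulmxA addrC addrK.
have cEf s : J s -> (fun s => E s *m f s) @ within J (nbhs s) --> E s *m f s.
  move=> Js; apply: cvg_mulmx; last exact: cf.
  exact: has_deriv_within_cvg (dE s).
have intEf x y (i : 'I_b) : J x -> J y -> x <= y ->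
    \int[lebesgue_measure]_(s in `[x, y]) (E s *m f s) i 0 = F y i 0 - F x i 0.
  move=> Jx Jy xy.
  apply: (Rintegral_has_deriv_within (F := fun s => F s i 0) J_itv Jx Jy xy).
    by move=> s Js; have /has_deriv_within_mxP/(_ i 0) := dF s Js.
  by move=> s Js; have /cvg_mxP/(_ i 0) := cEf s Js.
have -> : vec_integral (fun s => E s *m f s) 0 t = F t - F 0.
  apply/matrixP => i j; rewrite ord1 [LHS]mxE.
  have -> : (F t - F 0) i 0 = F t i 0 - F 0 i 0.
    by move: (F t) (F 0) => u v; rewrite !mxE.
  have [t0|/ltW t0] := leP 0 t; first exact: intEf.
  by rewrite intEf// opprB.
rewrite /F /E subrr subr0 mul0r scale0r expmx0 mul1mx !mul_scalar_mx.
by rewrite -scalemxAr -scalerBr scalerA mulVf// scale1r addrC subrK.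
Qed.

(** * The output system *)

Theorem lemma12p6 (R : realType) (n m : nat) (G : oriented_graph n m)
    (hG : graph_connected G)
    (M D : 'M[R]_n) (hM : pos_diag_mx M) (hD : pos_diag_mx D)
    (a : 'I_m -> R) (ha : forall e, 0 < a e)
    (theta_star : 'cV[R]_n) (u_star : 'cV[R]_m)
    (H : 'M[R]_(m, betti1 n m))
    (tau : R) (htau : 0 < tau) (ns na : nat)
    (S : 'M[R]_(ns, m)) (K : 'M[R]_(na, ns)) (C : 'M[R]_(m, na))
    (J : set R) (hJ : is_interval J)
    (vartheta nu : R -> 'cV[R]_n) (w : R -> 'cV[R]_m) :
  let B := incidence R G in
  let eta_star := B^T *m theta_star + u_star in
  let W := edge_weight_mx a eta_star in
  let L := C *m K *m S in
  let Cut := cut_space W B in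
  let r := tangent_output W B vartheta w in
  let rC := fun t => proj_C W H *m r t in
  let h := fun t => H^T *m invmx W *m r t in
  let LCC := block_CC W B H L in
  let LCH := block_CH W B H L in
  let LHC := block_HC W B H L in
  let LHH := block_HH W H L in
  angle_cohesive eta_star ->
  orthonormal_cycle_basis W B H ->
  tangent_solution M D W B tau S K C J vartheta nu w ->
  [/\ [/\ (Cut + ker_space B)%VS = fullv,
          directv (Cut + ker_space B)
        & (forall x y, x \in Cut -> y \in ker_space B ->
             x^T *m invmx W *m y = 0)],
      (forall t, J t -> rC t \in Cut /\ r t = rC t + H *m h t),
      (forall t, J t ->
        [/\ (exists2 dnu, has_deriv_within J nu t dnu
              & M *m dnu = - (D *m nu t) - B *m rC t),
            (exists2 drC, has_deriv_within J rC t drC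
              & tau *: drC = tau *: (W *m B^T *m nu t)
                  + vsval (LCC (vsproj Cut (rC t))) + vsval (LCH (h t)))
          & (exists2 dh, has_deriv_within J h t dh
              & tau *: dh = LHC (vsproj Cut (rC t)) + LHH *m h t)])
    & (J 0 -> forall t, J t ->
        h t = expmx ((t / tau) *: LHH) *m h 0
              + tau^-1 *: vec_integral (fun s =>
                  expmx (((t - s) / tau) *: LHH) *m
                    LHC (vsproj Cut (rC s))) 0 t)].
Proof.
move=> B eta W L Cut r rC h LCC LCH LHC LHH eta_coh H_basis sol.
have W_unit : W \in unitmx by exact: edge_weight_unitmx.
have W_sym : W^T = W by exact: tr_diag_mx.
have tau0 : tau != 0 by rewrite gt_eqF.
have rC_cut t : rC t \in Cut by exact: proj_C_cut.
have r_split t : r t = rC t + H *m h t by exact: cut_cycle_split.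
(* The output equation: [tau W w' = L r] because [W] cancels [invmx W]. *)
have dr t : J t -> exists2 dr, has_deriv_within J r t dr
    & tau *: dr = tau *: (W *m B^T *m nu t) + L *m r t.
  move=> Jt; have [dvt _ [dw wdw dwE]] := sol t Jt.
  exists (W *m B^T *m nu t + W *m dw).
    by apply: has_deriv_withinD; exact: has_deriv_within_mulmxl.
  by rewrite scalerDr [in X in _ + X]scalemxAr dwE mulKVmx//.
have drC t : J t -> exists2 drC, has_deriv_within J rC t drC
    & tau *: drC = tau *: (W *m B^T *m nu t)
        + vsval (LCC (vsproj Cut (rC t))) + vsval (LCH (h t)).
  move=> Jt; have [drt rdr drE] := dr t Jt.
  exists (proj_C W H *m drt); first exact: has_deriv_within_mulmxl.
  rewrite block_CCE// block_CHE// scalemxAr drE mulmxDr -scalemxAr mulmxA.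
  by rewrite (proj_C_cut_mx W_unit H_basis) r_split !mulmxDr !mulmxA addrA.
have dh t : J t -> exists2 dh, has_deriv_within J h t dh
    & tau *: dh = LHC (vsproj Cut (rC t)) + LHH *m h t.
  move=> Jt; have [drt rdr drE] := dr t Jt.
  exists (H^T *m invmx W *m drt); first exact: has_deriv_within_mulmxl.
  rewrite block_HCE// scalemxAr drE mulmxDr -scalemxAr mulmxA.
  rewrite (cycle_coord_cut W_unit H_basis) mul0mx scaler0 add0r r_split.
  by rewrite !mulmxDr /LHH /block_HH !mulmxA.
split.
- split; [exact: cut_add_ker H_basis | exact: cut_directv_ker H_basis |].
  by move=> x y; exact: cut_orthogonal_ker.
- by move=> t _; split.
- move=> t Jt; split; [|exact: drC|exact: dh].
  have [_ [dnu nu_dnu dnuE] _] := sol t Jt; exists dnu => //.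
  by rewrite dnuE (mulmx_proj_C H_basis).
- move=> J0 t Jt; apply: (variation_of_constants hJ tau0 J0 dh) => // s Js.
  have [drCs rCs _] := drC s Js.
  under eq_fun do rewrite (block_HCE H L (rC_cut _)).
  rewrite block_HCE//; apply: cvg_mulmx; first exact: cvg_cst.
  exact: has_deriv_within_cvg rCs.
Qed.
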